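(* Let $n\ge 0$ be an integer and let $u:\{-n,\dots,n\}\to\mathbb{R}$ be a symmetric function (that is, $u(-k)=u(k)$ for all $k$) with normalization $\sum_{k=-n}^{n}u(k)=1$ and nonnegative Fourier transform, i.e. $\widehat{u}(\xi)\ge 0$ for all $\xi$. Then $$\sup_{0\neq f\in\ell^2(\mathbb{Z})}\frac{\|\Delta(f*u)\|_{\ell^2(\mathbb{Z})}}{\|f\|_{\ell^2(\mathbb{Z})}}\;\geq\;\frac{4}{(n+1)^2},$$ with equality if and only if $u$ is the triangle function $u(k)=(n+1-|k|)/(n+1)^2$ for all $k\in\{-n,\dots,n\}$.
   Context: Functions $f\in\ell^2(\mathbb{Z})$ are complex-valued. The function $u$ is extended by $0$ to all of $\mathbb{Z}$, and $(f*u)(k)=\sum_{m\in\mathbb{Z}}f(k-m)u(m)$. The discrete Laplacian (second derivative) of $g:\mathbb{Z}\to\mathbb{C}$ is $(\Delta g)(k)=g(k+2)-2g(k+1)+g(k)$. The Fourier transform of $u$ is $\widehat{u}(\xi)=\sum_{k=-n}^{n}u(k)e^{-i\xi k}$ for $\xi\in\mathbb{T}=\mathbb{R}/2\pi\mathbb{Z}$ (it is real-valued since $u$ is real and symmetric). *)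

(* Defs.v *)
From mathcomp Require Import all_boot all_order all_algebra.
From mathcomp Require Import all_classical all_reals all_analysis.
From mathcomp Require Import complex.

Set Implicit Arguments.
Unset Strict Implicit.
Unset Printing Implicit Defensive.

Import Order.TTheory GRing.Theory Num.Theory.

Local Open Scope classical_set_scope.
Local Open Scope ring_scope.
Local Open Scope complex_scope.

Definition window (n : nat) : set int := [set k : int | (`|k| <= n)%N].

(* The sum in [\sum_(m \in [set: int])] ranges over the support of the summand
   and is 0 by convention if that support is infinite, so this is the
   convolution as soon as [u] is finitely supported. *)
Definition convolution (R : realType) (f : int -> R[i]) (u : int -> R) : int -> R[i] :=
  fun k => \sum_(m \in [set: int]) f (k - m) * (u m)%:C.

Definition laplacian (R : realType) (g : int -> R[i]) : int -> R[i] :=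
  fun k => g (k + 2) - 2 * g (k + 1) + g k.

Definition expi (R : realType) (t : R) : R[i] := cos t +i* sin t.

Definition fourier (R : realType) (n : nat) (u : int -> R) (xi : R) : R[i] :=
  \sum_(k \in window n) (u k)%:C * expi (- (xi * k%:~R)).

(* Extended-real valued: [+oo] exactly when [f] is not square summable. *)
Definition l2norm (R : realType) (f : int -> R[i]) : \bar R :=
  sqrte (\esum_(k in [set: int]) (ComplexField.Normc.normc (f k) ^+ 2)%:E)%E.

Definition in_l2 (R : realType) (f : int -> R[i]) : Prop := (l2norm f < +oo)%E.

Definition laplacian_conv_sup (R : realType) (u : int -> R) : \bar R :=
  ereal_sup [set (l2norm (laplacian (convolution f u)) / l2norm f)%E
            | f in [set f : int -> R[i] | in_l2 f /\ f <> cst 0]].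

Definition triangle (R : realType) (n : nat) (k : int) : R :=
  (n.+1%:R - `|k|%:~R) / n.+1%:R ^+ 2.

(* Main.v *)
Require Import Defs.
From mathcomp Require Import all_boot all_order all_algebra.
From mathcomp Require Import all_classical all_reals all_analysis.
From mathcomp Require Import complex.
From mathcomp Require Import ring lra zify.

(** Write N = n + 1, p for the Fourier transform of u, T for the triangle
    function and t for its Fourier transform (the Fejer kernel).

    The map f |-> Delta (f * u) is a Fourier multiplier of modulus
    p(xi) (2 - 2 cos xi), so the supremum S dominates each value of this symbol.
    Truncated characters are enough to see it: away from the two ends of its
    support such an f is turned into itself times the symbol, and the ends weigh
    nothing as the support grows ([symbol_le_laplacian_conv_sup]).

    It remains to bound the symbol from below, and the 2N points pi s / N
    suffice.  Every trigonometric polynomial q of degree less than N satisfies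
    sum_s (-1)^s q(pi s / N) = 0 ([alternating_sum_fourier]).  On the other hand
    t(xi) (2 - 2 cos xi) = (2 - 2 cos (N xi)) / N^2 ([fourier_triangle]), so t
    vanishes at the even nodes other than 0, and its symbol is equal to 4 / N^2
    at the odd ones.  Suppose that S <= M and put c = M N^2 / 4.  Then p <= c t
    at the odd nodes, and p >= 0 = c t at the even nodes other than 0, so all
    terms with s > 0 in
      sum_s (-1)^s (p - c t)(pi s / N) = 0
    are nonnegative, while the term s = 0 is 1 - c.  Hence c >= 1, that is,
    M >= 4 / N^2.  If c = 1 then all terms vanish: p and t agree at all 2N
    nodes, and a discrete Fourier inversion gives u = T ([node_extremal]).

    Conversely, the second difference of T consists of three point masses:
      Delta (f * T)(k) = (f(k+1+N) - 2 f(k+1) + f(k+1-N)) / N^2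
    ([laplacian_triangle]).  The coefficients 1, -2, 1 have absolute sum 4, so
    the operator norm is at most 4 / N^2 by the Cauchy-Schwarz inequality and
    the shift invariance of the l^2 norm ([l2norm_second_difference]).
    The same formula, applied to characters, yields the expression for t, and
    applied to f(j) = j^2 / 2 it yields t(0) = 1. *)

Set Implicit Arguments.
Unset Strict Implicit.
Unset Printing Implicit Defensive.

Import Order.TTheory GRing.Theory Num.Theory.

Local Open Scope classical_set_scope.
Local Open Scope ring_scope.
Local Open Scope complex_scope.

Local Notation normc := ComplexField.Normc.normc.

(** * Sums over the window *)

(** The recursive enumeration, rather than an increasing one, makes the sums
    over consecutive windows differ by two explicit terms; this is what the
    summation by parts for the triangle function inducts on. *)
Fixpoint window_seq (n : nat) : seq int :=
  if n is n'.+1 then n'.+1%:Z :: - n'.+1%:Z :: window_seq n' else [:: 0].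

Lemma mem_window_seq n (k : int) : (k \in window_seq n) = (`|k| <= n)%N.
Proof.
elim: n => [|n IHn] /=; first by rewrite inE; lia.
by rewrite !inE IHn; lia.
Qed.

Lemma window_seq_uniq n : uniq (window_seq n).
Proof.
elim: n => [//|n IHn] /=.
by rewrite !inE !mem_window_seq IHn; lia.
Qed.

Lemma fsbig_window (V : nmodType) n (F : int -> V) :
  \sum_(k \in window n) F k = \sum_(k <- window_seq n) F k.
Proof.
rewrite (fsbig_seq _ _ (window_seq_uniq n)).
by apply: eq_fsbigl; apply/seteqP; split=> k /=; rewrite mem_window_seq.
Qed.

(** * Characters and windowed convolutions *)

Section Characters.
Variable R : realType.
Implicit Types (s t xi : R) (m k : int) (n : nat).

Lemma expi0 : expi 0 = 1 :> R[i].
Proof. by rewrite /expi cos0 sin0. Qed.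

Lemma expiD s t : expi (s + t) = expi s * expi t.
Proof.
rewrite /expi cosD sinD; apply/eqP; rewrite eq_complex /=.
by apply/andP; split; apply/eqP; ring.
Qed.

Lemma expiM_nat t (j : nat) : expi (t * j%:R) = expi t ^+ j.
Proof.
elim: j => [|j IHj]; first by rewrite mulr0 expi0.
by rewrite exprS -natr1 mulrDr mulr1 addrC expiD IHj.
Qed.

Lemma expi_pi : expi (pi : R) = -1.
Proof. by rewrite /expi cospi sinpi; apply/eqP; rewrite eq_complex /= oppr0 !eqxx. Qed.

(** This is [4 * sin (t / 2) ^+ 2] with [0 < `|t / 2| < pi]. *)
Lemma two_sub_2cos_gt0 t : 0 < `|t| < 2 * pi -> 0 < 2 - 2 * cos t.
Proof.
wlog t0 : t / 0 <= t => [H|].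
  by case: (lerP 0 t) => [/H//|/ltW t0]; rewrite -normrN -cosN;
    apply: H; rewrite oppr_ge0.
rewrite ger0_norm // => /andP[tgt0 tlt].
have -> : cos t = cos (t / 2 + t / 2) by congr cos; field.
rewrite cosD -!expr2 cos2sin2.
have : 0 < sin (t / 2) by apply: sin_gt0_pi; rewrite ?divr_gt0 //; lra.
nra.
Qed.

(** The symbol of the second difference, which runs over 0, 1, 2 instead of -1, 0, 1;
    this accounts for the unimodular factor. *)
Lemma sqr_expiB1 t : (expi t - 1) ^+ 2 = - (expi t * (2 - 2 * cos t)%:C).
Proof.
rewrite /expi; move: (cos t) (sin t) (sin2cos2 t) => c s cs.
rewrite expr2; apply/eqP; rewrite eq_complex /=.
by apply/andP; split; apply/eqP; ring: cs.
Qed.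

Lemma normc_expi t : normc (expi t) = 1.
Proof. by rewrite /expi /normc cos2Dsin2 sqrtr1. Qed.

Definition window_conv n (f : int -> R[i]) (u : int -> R) : int -> R[i] :=
  fun k => \sum_(m <- window_seq n) f (k - m) * (u m)%:C.

Lemma convolution_window n (u : int -> R) (f : int -> R[i]) :
  (forall k, (n < `|k|)%N -> u k = 0) -> convolution f u = window_conv n f u.
Proof.
move=> u0; apply/funext => k; rewrite /convolution /window_conv -fsbig_window.
apply/esym/fsbig_widen => // m [_ /= /negP]; rewrite -ltnNge => /u0 ->.
by rewrite mulr0.
Qed.

Lemma laplacian_window_conv n (u : int -> R) (f : int -> R[i]) k :
  laplacian (window_conv n f u) k =
  \sum_(m <- window_seq n) laplacian f (k - m) * (u m)%:C.
Proof.
rewrite /laplacian /window_conv mulr_sumr -sumrB -big_split /=.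
apply: eq_bigr => m _; by rewrite (addrAC k 2) (addrAC k 1); ring.
Qed.

Lemma fourier_window n (u : int -> R) xi :
  fourier n u xi = \sum_(k <- window_seq n) (u k)%:C * expi (- (xi * k%:~R)).
Proof. exact: fsbig_window. Qed.

(** The agreement is only required near [k], so that truncated characters,
    which are square summable, are covered. *)
Lemma laplacian_window_conv_expi n (u : int -> R) (f : int -> R[i]) xi k :
  (forall j, k - n%:Z <= j <= k + n%:Z + 2 -> f j = expi (xi * j%:~R)) ->
  laplacian (window_conv n f u) k =
  expi (xi * k%:~R) * fourier n u xi * (expi xi - 1) ^+ 2.
Proof.
move=> fE; rewrite laplacian_window_conv fourier_window mulr_sumr mulr_suml.
apply: eq_big_seq => m; rewrite mem_window_seq => mn.
rewrite /laplacian !fE; try lia.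
have e2 : expi (xi * (2 : int)%:~R) = expi xi ^+ 2.
  by rewrite -expiM_nat.
have eD j : expi (xi * (k - m + j)%:~R) =
    expi (xi * k%:~R) * expi (- (xi * m%:~R)) * expi (xi * j%:~R).
  by rewrite -!expiD !intrD mulrNz; congr expi; ring.
by rewrite -[k - m in X in _ + X]addr0 !eD e2 mulr1 mulr0 expi0; ring.
Qed.

End Characters.

(** * The triangle function *)

Section Triangle.
Variable R : realType.
Implicit Types (f : int -> R[i]) (k : int) (n : nat) (xi : R).

(** The second difference telescopes to first differences at the two ends. *)
Lemma sum_laplacian n f k :
  \sum_(m <- window_seq n) laplacian f (k - m) =
  f (k + 1 + n.+1%:Z) - f (k + 1 + n%:Z) - (f (k + 1 - n%:Z) - f (k + 1 - n.+1%:Z)).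
Proof.
elim: n => [|n IHn].
  rewrite big_seq1 /laplacian subr0 addr0 addrK -[k + 1 + 1%:Z]addrA; ring.
rewrite !big_cons IHn /laplacian.
have -> : k - n.+1%:Z + 2 = k + 1 - n%:Z by lia.
have -> : k - n.+1%:Z + 1 = k + 1 - n.+1%:Z by lia.
have -> : k - n.+1%:Z = k + 1 - n.+2%:Z by lia.
have -> : k - - n.+1%:Z + 2 = k + 1 + n.+2%:Z by lia.
have -> : k - - n.+1%:Z + 1 = k + 1 + n.+1%:Z by lia.
have -> : k - - n.+1%:Z = k + 1 + n%:Z by lia.
ring.
Qed.

(** Summation by parts: the weights of the window [n.+1] exceed those of the
    window [n] by 1 everywhere on the larger window, and the unweighted sum is
    [sum_laplacian]. *)
Lemma sum_laplacian_weighted n f k :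
  \sum_(m <- window_seq n) laplacian f (k - m) * (n.+1%:R - `|m|%:~R) =
  f (k + 1 + n.+1%:Z) - 2 * f (k + 1) + f (k + 1 - n.+1%:Z).
Proof.
elim: n => [|n IHn].
  by rewrite big_seq1 /laplacian !subr0 addrK -[k + 1 + 1%:Z]addrA mulr1.
have -> : \sum_(m <- window_seq n.+1) laplacian f (k - m) * (n.+2%:R - `|m|%:~R) =
    \sum_(m <- window_seq n) laplacian f (k - m) * (n.+1%:R - `|m|%:~R) +
    \sum_(m <- window_seq n.+1) laplacian f (k - m).
  rewrite !big_cons normrN -[`|n.+1%:Z|]/(n.+1%:Z) -pmulrn.
  rewrite -[n.+2%:R]natr1 addrAC subrr add0r !mulr1.
  rewrite [RHS]addrCA; congr (_ + _); rewrite [RHS]addrCA; congr (_ + _).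
  rewrite -big_split /=; apply: eq_bigr => m _.
  by rewrite -natr1; ring.
rewrite IHn sum_laplacian; ring.
Qed.

Lemma laplacian_triangle n f k :
  laplacian (window_conv n f (triangle R n)) k =
  (f (k + 1 + n.+1%:Z) - 2 * f (k + 1) + f (k + 1 - n.+1%:Z)) / n.+1%:R ^+ 2.
Proof.
rewrite laplacian_window_conv -sum_laplacian_weighted mulr_suml.
apply: eq_bigr => m _; rewrite -mulrA; congr (_ * _).
rewrite /triangle rmorphM rmorphB /= fmorphV rmorphXn /=.
by rewrite !rmorph_nat.
Qed.

(** The function j^2 / 2 has constant second difference 1, so convolving it with
    the triangle function and applying [laplacian] returns the mass of the
    latter. *)
Lemma sum_triangle n : \sum_(m <- window_seq n) (triangle R n m)%:C = 1 :> R[i].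
Proof.
pose f (j : int) : R[i] := j%:~R ^+ 2 / 2.
have lapf j : laplacian f j = 1.
  by rewrite /laplacian /f (intrD _ j 2) (intrD _ j 1); field.
have := laplacian_triangle n f 0.
rewrite laplacian_window_conv; under eq_bigr do rewrite lapf mul1r.
move=> ->; rewrite /f !add0r intrB intrD -!pmulrn.
have : n.+1%:R != 0 :> R[i] by rewrite pnatr_eq0.
by move: (n.+1%:R) => N N0; field.
Qed.

(** The closed form of the Fejer kernel, obtained by computing the image of a
    character in two ways: by its symbol and by [laplacian_triangle]. *)
Lemma fourier_triangle n xi :
  fourier n (triangle R n) xi * (2 - 2 * cos xi)%:C =
  (2 - 2 * cos (xi * n.+1%:R))%:C / n.+1%:R ^+ 2.
Proof.
pose f (j : int) := expi (xi * j%:~R).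
have := @laplacian_window_conv_expi R n (triangle R n) f xi 0 (fun j _ => erefl).
rewrite laplacian_triangle sqr_expiB1 /f mulr0z mulr0 expi0 mul1r !add0r mulr1.
rewrite intrD intrB -pmulrn mulrBr mulrDr mulr1 2!expiD.
set F := fourier _ _ _ => eqF.
set t := xi * n.+1%:R in eqF *.
have N0 : n.+1%:R != 0 :> R[i] by rewrite pnatr_eq0.
set N : R[i] := n.+1%:R in eqF N0 *.
have cosE : (2 - 2 * cos t)%:C = 2 - (expi t + expi (- t)).
  rewrite /expi cosN sinN; apply/eqP; rewrite eq_complex /=.
  by apply/andP; split; apply/eqP; ring.
have expiV : expi (- xi) * expi xi = 1 by rewrite -expiD addNr expi0.
have -> : F * (2 - 2 * cos xi)%:C =
    - (expi (- xi) * (F * - (expi xi * (2 - 2 * cos xi)%:C))).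
  by ring: expiV.
by rewrite -eqF cosE; field: expiV.
Qed.

End Triangle.

(** * Interpolation at the 2N nodes *)

Section Nodes.
Variables (R : realType) (n : nat).
Implicit Types (u v : int -> R) (k m : int).

Definition node (s : nat) : R := pi * s%:R / n.+1%:R.

Let N0 : n.+1%:R != 0 :> R. Proof. by rewrite pnatr_eq0. Qed.
Let Ngt0 : 0 < n.+1%:R :> R. Proof. by rewrite ltr0n. Qed.

Lemma expi_2pi_int m : expi (2 * pi * m%:~R) = 1 :> R[i].
Proof.
have e1 : expi (2 * pi : R) = 1.
  by rewrite mulrC expiM_nat expi_pi sqrrN expr1n.
case: m => j; first by rewrite -pmulrn expiM_nat e1 expr1n.
have /(congr1 ( *%R (expi (2 * pi * (j.+1%:R : R))))) :
  expi (2 * pi * (Negz j)%:~R) * expi (2 * pi * (j.+1%:R : R)) = 1.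
  by rewrite -expiD NegzE mulrNz -pmulrn mulrN addNr expi0.
by rewrite mulrCA expiM_nat e1 expr1n !mulr1.
Qed.

(** A sum over the 2N-th roots of unity of a nontrivial character. *)
Lemma sum_expi_node m : m != 0 -> (`|m| < n.+1.*2)%N ->
  \sum_(s < n.+1.*2) expi (node s * m%:~R) = 0.
Proof.
move=> m0 mN; pose z := expi (pi * m%:~R / n.+1%:R : R).
have zE (s : nat) : expi (node s * m%:~R) = z ^+ s.
  by rewrite /z -expiM_nat /node; congr expi; ring.
have z1 : z - 1 != 0.
  have: 0 < 2 - 2 * cos (pi * m%:~R / n.+1%:R) :> R.
    apply: two_sub_2cos_gt0.
    have pi0 := pi_gt0 R.
    rewrite !normrM normfV (gtr0_norm pi0) (gtr0_norm Ngt0).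
    rewrite divr_gt0 ?mulr_gt0 ?normr_gt0 ?intr_eq0 //=.
    rewrite ltr_pdivrMr // (mulrC 2) -mulrA ltr_pM2l // -natrM.
    rewrite -intr_norm -[`|m|]abszE -pmulrn ltr_nat; lia.
  apply: contraTneq => /(congr1 (fun x => x ^+ 2)); rewrite sqr_expiB1 expr0n /=.
  move=> /eqP; rewrite oppr_eq0 mulf_eq0 => /orP[/eqP z0|].
    by have := @normc_expi R (pi * m%:~R / n.+1%:R);
      rewrite z0 ComplexField.Normc.normc0 => /esym/eqP; rewrite oner_eq0.
  by rewrite fmorph_eq0 => /eqP ->; rewrite ltxx.
apply: (mulfI z1); rewrite mulr0.
under eq_bigr do rewrite zE.
rewrite -subrX1 /z -expiM_nat.
rewrite (_ : _ * _ = 2 * pi * m%:~R) ?expi_2pi_int ?subrr //.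
by rewrite -muln2 natrM; field.
Qed.

Lemma expi_node_N s : expi (node s * n.+1%:R) = (-1) ^+ s.
Proof. by rewrite /node divfK // expiM_nat expi_pi. Qed.

Lemma cos_node_N s : cos (node s * n.+1%:R) = (-1) ^+ s.
Proof.
have /(congr1 (@complex.Re R)) : expi (node s * n.+1%:R) = ((-1) ^+ s)%:C.
  by rewrite expi_node_N rmorphXn rmorphN1.
exact: id.
Qed.

(** The sign [(-1) ^+ s] is the character of frequency N at the node [s]; since
    [`|k| <= n], the frequency N - k lies strictly between 0 and 2N, so each
    exponential of the polynomial is summed to 0. *)
Lemma alternating_sum_fourier v :
  \sum_(s < n.+1.*2) (-1) ^+ s * fourier n v (node s) = 0.
Proof.
under eq_bigr do rewrite fourier_window mulr_sumr.
rewrite exchange_big /= big_seq big1 // => k; rewrite mem_window_seq => kn.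
under eq_bigr => s _.
  rewrite mulrCA -expi_node_N -expiD.
  rewrite (_ : _ + _ = node s * (n.+1%:Z - k)%:~R); first over.
  by rewrite intrB -pmulrn mulrBr.
by rewrite -mulr_sumr sum_expi_node ?mulr0 //; lia.
Qed.

(** Discrete Fourier inversion: two frequencies in the window differ by at most
    2n, which is less than the number 2N of nodes, so none is aliased. *)
Lemma fourier_inj_node u v :
  (forall s, (s < n.+1.*2)%N -> fourier n u (node s) = fourier n v (node s)) ->
  forall k, (`|k| <= n)%N -> u k = v k.
Proof.
move=> uv l ln.
have : \sum_(s < n.+1.*2) expi (node s * l%:~R) *
    (fourier n u (node s) - fourier n v (node s)) = 0.
  by rewrite big1 // => s _; rewrite uv ?subrr ?mulr0.
under eq_bigr do rewrite !fourier_window -sumrB mulr_sumr.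
rewrite exchange_big /= (bigD1_seq l) ?mem_window_seq ?window_seq_uniq //=.
rewrite [X in _ + X]big_seq_cond [X in _ + X]big1 ?addr0; last first.
  move=> k /andP[]; rewrite mem_window_seq => kn kl.
  under eq_bigr => s _.
    rewrite -mulrBl mulrCA -expiD.
    rewrite (_ : _ + _ = node s * (l - k)%:~R); first over.
    by rewrite intrB mulrBr.
  by rewrite -mulr_sumr sum_expi_node ?mulr0 ?subr_eq0 1?eq_sym //; lia.
under eq_bigr do rewrite -mulrBl mulrCA -expiD subrr expi0 mulr1.
rewrite sumr_const card_ord => /eqP; rewrite mulrn_eq0 /= subr_eq0 => /eqP.
by case.
Qed.

(** The extremal problem, reduced to the 2N nodes: [c] compares [M] with the
    value 4 / N^2 that the symbol of the triangle function takes at each odd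
    node. *)
Lemma node_extremal u (M : R) (c := M * n.+1%:R ^+ 2 / 4) :
  \sum_(k <- window_seq n) u k = 1 ->
  (forall xi, 0 <= fourier n u xi) ->
  (forall xi, fourier n u xi * (2 - 2 * cos xi)%:C <= M%:C) ->
  1 <= c /\
  (c = 1 -> forall k, (`|k| <= n)%N -> u k = triangle R n k).
Proof.
move=> u1 p_ge0 pM.
have fourier0 v : fourier n v 0 = (\sum_(k <- window_seq n) v k)%:C.
  rewrite fourier_window rmorph_sum; apply: eq_bigr => k _.
  by rewrite mul0r oppr0 expi0 mulr1.
pose p s := fourier n u (node s); pose t s := fourier n (triangle R n) (node s).
pose D s := (-1) ^+ s * (p s - c%:C * t s).
have D0 : D 0%N = 1 - c%:C.
  rewrite /D /p /t /node mulr0 mul0r !fourier0 u1 rmorph_sum sum_triangle.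
  by rewrite mul1r mulr1.
have D_ge0 s : (s < n.*2.+1)%N -> 0 <= D s.+1.
  move=> sN.
  (* The sign can be tested after multiplication by this positive factor, which
     turns p and t into the two symbols. *)
  have d0 : 0 < 2 - 2 * cos (node s.+1).
    apply: two_sub_2cos_gt0; rewrite /node.
    have pi0 := pi_gt0 R.
    rewrite gtr0_norm ?divr_gt0 ?mulr_gt0 ?ltr0n //=.
    rewrite ltr_pdivrMr // (mulrC 2) -mulrA ltr_pM2l // -natrM ltr_nat; lia.
  have tE : t s.+1 * (2 - 2 * cos (node s.+1))%:C =
      (2 - 2 * cos (node s.+1 * n.+1%:R))%:C / n.+1%:R ^+ 2.
    exact: fourier_triangle.
  have cosN := cos_node_N s.+1.
  have Nc0 : (n.+1%:R ^+ 2 : R[i]) != 0 by rewrite expf_eq0 pnatr_eq0.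
  rewrite -(pmulr_lge0 _ (x := (2 - 2 * cos (node s.+1))%:C)) ?ltcR //.
  rewrite /D -mulrA mulrBl -mulrA tE cosN -(signr_odd R) -(signr_odd R[i]).
  case: odd; rewrite ?expr1 ?expr0.
    rewrite mulN1r opprB subr_ge0; apply: le_trans (pM _) _.
    have -> : (2 - 2 * -1)%:C = 4 :> R[i].
      by rewrite -[RHS](rmorph_nat (real_complex R)); congr (_%:C); ring.
    suff -> : M%:C = c%:C * (4 / n.+1%:R ^+ 2) by [].
    by rewrite /c rmorphM (rmorphM _ M) fmorphV rmorphXn /= !rmorph_nat; field.
  rewrite mulr1 subrr mul0r mulr0 subr0 mul1r.
  by rewrite mulr_ge0 ?p_ge0 ?lecR ?ltW.
have sumD : \sum_(s < n.+1.*2) D s = 0.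
  under eq_bigr do rewrite /D mulrBr mulrCA.
  by rewrite sumrB -mulr_sumr !alternating_sum_fourier mulr0 subr0.
move: sumD; rewrite big_ord_recl D0 /= => sumD.
have rest_ge0 : 0 <= \sum_(s < n.*2.+1) D s.+1.
  by apply: sumr_ge0 => s _; exact: D_ge0.
split.
  by rewrite -lecR -subr_le0 -(lerD2r (\sum_(s < n.*2.+1) D s.+1)) sumD add0r.
move=> c1; apply: fourier_inj_node => s sN.
have Ds s' : (s' < n.*2.+1)%N -> D s'.+1 = 0.
  move=> s'N; move: sumD; rewrite c1 subrr add0r => /psumr_eq0P.
  by move/(_ _ (Ordinal s'N)); apply=> // i _; exact: D_ge0.
have {sN Ds} : D s = 0.
  by case: s sN => [_|s sN]; [rewrite D0 c1 subrr | exact: Ds].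
move=> /eqP; rewrite /D c1 mul1r mulf_eq0 signr_eq0 /= subr_eq0 => /eqP.
exact: id.
Qed.

End Nodes.

(** * Square sums over the integers *)

Section Norms.
Variable R : realType.
Implicit Types (f g : int -> R[i]) (k : int) (n : nat).

Lemma esum_ge_seq (r : seq int) (a : int -> \bar R) : uniq r ->
  (\sum_(k <- r) a k <= \esum_(k in [set: int]) a k)%E.
Proof.
move=> ur; apply: esum_ge; exists [set` r]; first by split=> //; exact: finite_seq.
by rewrite fsbig_seq.
Qed.

Lemma esum_seq (r : seq int) (a : int -> \bar R) : uniq r ->
  (forall k, 0 <= a k)%E -> (forall k, k \notin r -> a k = 0%E) ->
  \esum_(k in [set: int]) a k = (\sum_(k <- r) a k)%E.
Proof.
move=> ur a0 ar; rewrite fsbig_seq // -esum_fset // esum_mkcond.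
rewrite [RHS]esum_mkcond; apply: eq_esum => k _.
by rewrite in_setT mem_setE; case: ifPn => // /ar.
Qed.

Lemma esum_shift (a : int -> \bar R) j :
  \esum_(k in [set: int]) a (k + j) = \esum_(k in [set: int]) a k.
Proof.
apply/esym/reindex_esum; rewrite setTT_bijective.
by exists (fun k => k - j) => k; rewrite ?addrK ?subrK.
Qed.

Lemma le_esumZ (c : R) (a : int -> \bar R) : 0 <= c -> (forall k, 0 <= a k)%E ->
  (\esum_(k in [set: int]) (c%:E * a k) <= c%:E * \esum_(k in [set: int]) a k)%E.
Proof.
move=> c0 a0; apply: ge_ereal_sup => _ [X [finX _] <-].
rewrite -ge0_mule_fsumr // lee_wpmul2l ?lee_fin //.
by apply: ereal_sup_ubound; exists X.
Qed.

Definition sqnormc (z : R[i]) : R := normc z ^+ 2.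

Lemma sqnormcE z : sqnormc z = complex.Re z ^+ 2 + complex.Im z ^+ 2.
Proof. by case: z => a b; rewrite /sqnormc /= sqr_sqrtr // addr_ge0 ?sqr_ge0. Qed.

Lemma normc_real (x : R) : normc x%:C = `|x|.
Proof. by rewrite /normc /= expr0n addr0 sqrtr_sqr. Qed.

Lemma sqnormcMr z (r : R) : sqnormc (z * r%:C) = sqnormc z * r ^+ 2.
Proof. by rewrite !sqnormcE; case: z => a b /=; ring. Qed.

Lemma sqnormc_ge0 z : 0 <= sqnormc z.
Proof. exact: sqr_ge0. Qed.

(** Cauchy-Schwarz with weights 1, 2, 1. *)
Lemma sqnormc_second_difference (a b c : R[i]) :
  sqnormc (a - 2 * b + c) <= 4 * (sqnormc a + sqnormc b + sqnormc b + sqnormc c).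
Proof.
have key (x y z : R) : (x - 2 * y + z) ^+ 2 <= 4 * (x ^+ 2 + y ^+ 2 + y ^+ 2 + z ^+ 2).
  by have := sqr_ge0 (x + y); have := sqr_ge0 (y + z); have := sqr_ge0 (x - z); nra.
case: a b c => [a1 a2] [b1 b2] [c1 c2]; rewrite !sqnormcE /=.
have := key a1 b1 c1; have := key a2 b2 c2; lra.
Qed.

Lemma l2norm_sqnormc f :
  l2norm f = sqrte (\esum_(k in [set: int]) (sqnormc (f k))%:E).
Proof. by []. Qed.

Lemma esum_sqnormc_gt0 f : f <> cst 0 ->
  (0 < \esum_(k in [set: int]) (sqnormc (f k))%:E)%E.
Proof.
move=> f0; have [k fk] : exists k, f k != 0.
  apply: contrapT => /forallNP h; apply: f0; apply/funext => k /=.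
  by apply/eqP/negPn/negP/h.
apply: lt_le_trans (@esum_ge_seq [:: k] _ isT).
rewrite big_seq1 lte_fin lt_neqAle sqnormc_ge0 andbT eq_sym.
rewrite sqrf_eq0; apply: contraNneq fk => /ComplexField.Normc.eq0_normc ->.
exact: eqxx.
Qed.

Lemma in_l2_sqsum f : in_l2 f -> f <> cst 0 -> exists2 A : R, 0 < A &
  \esum_(k in [set: int]) (sqnormc (f k))%:E = A%:E.
Proof.
rewrite /in_l2 l2norm_sqnormc => fin /esum_sqnormc_gt0; move: fin.
by case: (esum _ _) => // A _; exists A.
Qed.

Lemma l2norm_second_difference (N : nat) f g : (0 < N)%N ->
  (forall k, g k = (f (k + 1 + N%:Z) - 2 * f (k + 1) + f (k + 1 - N%:Z)) / N%:R ^+ 2) ->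
  in_l2 f -> f <> cst 0 -> (l2norm g / l2norm f <= (4 / N%:R ^+ 2)%:E)%E.
Proof.
move=> N0 gE f2 f0; have [A A0 fA] := in_l2_sqsum f2 f0.
have N0R : 0 < N%:R :> R by rewrite ltr0n.
pose c : R := 4 / N%:R ^+ 4.
have c0 : 0 <= c by rewrite divr_ge0 ?exprn_ge0 ?ler0n.
pose phi j k := (sqnormc (f (k + j)))%:E.
have phi0 j k : (0 <= phi j k)%E by rewrite lee_fin sqnormc_ge0.
have phiA j : \esum_(k in [set: int]) phi j k = A%:E.
  by rewrite -fA -[RHS](esum_shift _ j).
have gle : (\esum_(k in [set: int]) (sqnormc (g k))%:E <= (16 / N%:R ^+ 4 * A)%:E)%E.
  apply: (@le_trans _ _ (\esum_(k in [set: int])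
    (c%:E * (phi (1 + N%:Z)%R k + phi 1%R k + phi 1%R k + phi (1 - N%:Z)%R k))%E)).
    apply: le_esum => k _; rewrite -!EFinD -EFinM lee_fin gE !addrA.
    have -> : (N%:R ^+ 2)^-1 = ((N%:R ^+ 2)^-1)%:C :> R[i].
      by rewrite fmorphV rmorphXn /= rmorph_nat.
    rewrite sqnormcMr.
    apply: le_trans (ler_wpM2r (sqr_ge0 _) (sqnormc_second_difference _ _ _)) _.
    rewrite le_eqVlt; apply/orP; left; apply/eqP; rewrite /c; field.
    by rewrite gt_eqF.
  apply: le_trans (le_esumZ c0 _) _; first by move=> k; rewrite !adde_ge0.
  rewrite !esumD; try by move=> *; rewrite ?adde_ge0.
  rewrite !phiA -!EFinD -EFinM lee_fin.
  rewrite le_eqVlt; apply/orP; left; apply/eqP; rewrite /c; ring.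
rewrite !l2norm_sqnormc fA /= inver gt_eqF ?sqrtr_gt0 // lee_pdivrMr ?sqrtr_gt0 //.
rewrite -EFinM.
have -> : 4 / N%:R ^+ 2 * Num.sqrt A = Num.sqrt (16 / N%:R ^+ 4 * A).
  have q0 : 0 <= 4 / N%:R ^+ 2 :> R by rewrite divr_ge0 ?exprn_ge0 ?ler0n.
  have -> : 16 / N%:R ^+ 4 = (4 / N%:R ^+ 2) ^+ 2 :> R by field; rewrite gt_eqF.
  by rewrite sqrtrM ?sqr_ge0 // sqrtr_sqr ger0_norm.
by rewrite -[X in (_ <= X)%E]/(sqrte (16 / N%:R ^+ 4 * A)%:E) lee_sqrt ?lee_fin //
   mulr_ge0 ?divr_ge0 ?exprn_ge0 ?ler0n ?ltW.
Qed.

End Norms.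

(** * The symbol bounds the operator from below *)

Section LowerBound.
Variable R : realType.

Lemma le_of_linear_growth (a b c : R) :
  (forall l : nat, l%:R * a <= (l%:R + c) * b) -> a <= b.
Proof.
move=> h; rewrite leNgt; apply/negP => ba.
have := h (Num.Def.truncn (c * b / (a - b))).+1.
set l := _.+1; rewrite mulrDl -lerBlDl -mulrBr leNgt => /negP; apply.
rewrite -ltr_pdivrMr ?subr_gt0 //; exact: truncnS_gt.
Qed.

(** The test function is the character restricted to an interval of length
    [l + 2n + 2].  At the [l] points of the interval at which the stencil of
    the operator (n to the left, n + 2 to the right) does not leave it, the
    image has the modulus of the symbol; comparing square sums and letting [l]
    grow gives the bound. *)
Lemma symbol_le_laplacian_conv_sup n (u : int -> R) (M xi : R) :
  (forall k : int, (n < `|k|)%N -> u k = 0) ->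
  (laplacian_conv_sup u <= M%:E)%E ->
  normc (fourier n u xi) * (2 - 2 * cos xi) <= M.
Proof.
move=> u0 supM; set lam := _ * _.
have d0 : 0 <= 2 - 2 * cos xi by have := cos_le1 xi; lra.
have lam0 : 0 <= lam.
  by rewrite mulr_ge0 // /normc; case: fourier => a b; exact: sqrtr_ge0.
pose c := n.+1.*2.
pose f l : int -> R[i] := fun j =>
  if (0 <= j < (l + c)%N%:Z) then expi (xi * j%:~R) else 0.
have sumf l : \esum_(k in [set: int]) (sqnormc (f l k))%:E = (l + c)%N%:R%:E.
  rewrite (@esum_seq _ (map Posz (iota 0 (l + c)%N))).
  - rewrite big_map (eq_big_seq (fun _ => (1 : R)%:E)) => [|i].
      by rewrite sumEFin big_const_seq count_predT size_iota iter_addr_0.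
    rewrite mem_iota /f => iL; rewrite (_ : (_ <= _ < _) = true); last by lia.
    by rewrite /sqnormc normc_expi expr1n.
  - by rewrite map_inj_uniq ?iota_uniq // => i j [].
  - by move=> k; rewrite lee_fin sqnormc_ge0.
  - move=> k kL; rewrite /f ifF ?/sqnormc ?ComplexField.Normc.normc0 ?expr0n //.
    apply: contraNF kL => kL; apply/mapP; exists `|k|%N; last by lia.
    by rewrite mem_iota; lia.
have sumg l : ((l%:R * lam ^+ 2)%:E <=
    \esum_(k in [set: int]) (sqnormc (laplacian (convolution (f l) u) k))%:E)%E.
  have ur : uniq [seq (i + n)%N%:Z | i <- iota 0 l].
    by rewrite map_inj_uniq ?iota_uniq // => i j [] /addIn.
  apply: le_trans (esum_ge_seq _ ur).
  rewrite big_map (eq_big_seq (fun _ => (lam ^+ 2)%:E)) => [|i].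
    by rewrite sumEFin big_const_seq count_predT size_iota iter_addr_0 mulr_natl.
  rewrite mem_iota => il; rewrite (convolution_window _ u0).
  rewrite (@laplacian_window_conv_expi _ _ _ _ xi).
    rewrite /sqnormc sqr_expiB1 -mulrN -rmorphN !ComplexField.Normc.normcM !normc_expi.
    by rewrite /lam !mul1r normc_real normrN ger0_norm.
  by move=> j jn; rewrite /f ifT // /c; lia.
have ratio l : Num.sqrt (l%:R * lam ^+ 2) <= M * Num.sqrt (l + c)%N%:R.
  have L0 : 0 < (l + c)%N%:R :> R by rewrite ltr0n /c; lia.
  rewrite -lee_fin EFinM -lee_pdivrMr ?sqrtr_gt0 //.
  apply: le_trans supM; apply: le_trans (ereal_sup_ubound _); last first.
    exists (f l) => //; split.
      by rewrite /in_l2 l2norm_sqnormc sumf ltry.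
    move=> /(congr1 (fun h => h 0)); rewrite /f ifT; last by rewrite /c; lia.
    by rewrite mulr0 expi0 => /eqP; rewrite oner_eq0.
  rewrite !l2norm_sqnormc sumf /= inver gt_eqF ?sqrtr_gt0 //.
  apply: lee_wpmul2r; first by rewrite lee_fin invr_ge0 sqrtr_ge0.
  rewrite -[X in (X <= _)%E]/(sqrte (l%:R * lam ^+ 2)%:E).
  by rewrite lee_sqrt ?(le_trans _ (sumg l)) // lee_fin mulr_ge0 ?sqr_ge0.
have M0 : 0 <= M.
  have := ratio 0%N; rewrite mul0r sqrtr0 pmulr_lge0 // sqrtr_gt0 ltr0n /c; lia.
clearbody lam; rewrite -(@ler_pXn2r _ 2) ?nnegrE //.
apply: (@le_of_linear_growth _ _ c%:R) => l.
have := ratio l; rewrite -(@ler_pXn2r _ 2) ?nnegrE ?mulr_ge0 ?sqrtr_ge0 //.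
rewrite [(M * _) ^+ 2]exprMn !sqr_sqrtr ?mulr_ge0 ?sqr_ge0 ?ler0n // natrD.
by rewrite [X in _ <= X]mulrC.
Qed.

End LowerBound.

Lemma laplacian_conv_sup_triangle (R : realType) n (u : int -> R) :
  (forall k : int, (n < `|k|)%N -> u k = 0) ->
  (forall k : int, (`|k| <= n)%N -> u k = triangle R n k) ->
  (laplacian_conv_sup u <= (4 / n.+1%:R ^+ 2)%:E)%E.
Proof.
move=> u0 uT; apply: ge_ereal_sup => _ [f [f2 f0] <-].
apply: l2norm_second_difference => // k.
rewrite (convolution_window _ u0) -laplacian_triangle !laplacian_window_conv.
by apply: eq_big_seq => m; rewrite mem_window_seq => /uT ->.
Qed.

Theorem theorem2 (R : realType) (n : nat) (u : int -> R)
    (u_ext0 : forall k : int, (n < `|k|)%N -> u k = 0)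
    (u_sym : forall k : int, u (- k) = u k)
    (u_sum1 : \sum_(k \in window n) u k = 1)
    (u_hat_ge0 : forall xi : R, 0 <= fourier n u xi) :
  ((4 / n.+1%:R ^+ 2)%:E <= laplacian_conv_sup u)%E /\
  (laplacian_conv_sup u = (4 / n.+1%:R ^+ 2)%:E <->
   forall k : int, (`|k| <= n)%N -> u k = triangle R n k).
Proof.
have N2 : 0 < n.+1%:R ^+ 2 :> R by rewrite exprn_gt0 ?ltr0n.
have extremal (M : R) : (laplacian_conv_sup u <= M%:E)%E ->
    1 <= M * n.+1%:R ^+ 2 / 4 /\
    (M * n.+1%:R ^+ 2 / 4 = 1 -> forall k, (`|k| <= n)%N -> u k = triangle R n k).
  move=> supM; apply: node_extremal => // [|xi].
    by rewrite -fsbig_window.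
  rewrite -(ger0_norm (u_hat_ge0 xi)) -[`|_|]/((normc _)%:C) -rmorphM lecR.
  exact: symbol_le_laplacian_conv_sup.
have lower : ((4 / n.+1%:R ^+ 2)%:E <= laplacian_conv_sup u)%E.
  rewrite leNgt; apply/negP => lt; have := ltW lt.
  case sup: (laplacian_conv_sup u) lt => [M|//|].
    rewrite lte_fin ltr_pdivlMr // => MN _.
    have [|] := extremal M; first by rewrite sup.
    by rewrite leNgt ltr_pdivrMr // mul1r MN.
  have s0 : (laplacian_conv_sup u <= 0%:E)%E by rewrite sup leNye.
  by have [] := extremal _ s0; rewrite !mul0r ler10.
split=> //; split=> [sup|uT]; last first.
  by apply/eqP; rewrite eq_le lower andbT laplacian_conv_sup_triangle.
have [|_] := extremal (4 / n.+1%:R ^+ 2); first by rewrite sup.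
by apply; rewrite divfK ?gt_eqF // divff ?pnatr_eq0.
Qed.
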